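(* Let $X$ be a well-quasi-ordered poset. Let $L = \mathrm{Idl}(X) \setminus \{{\downarrow} x \mid x \in X\}$. Let $\gamma$ send each $x \in X$ to ${\downarrow} x$ and each $I \in L$ to $I$. Let $\preceq$ be defined on $L \cup X$ by $z \preceq z'$ iff $\gamma(z) \subseteq \gamma(z')$. Then: (a) $(L, \preceq, \gamma)$ is a weak adequate domain of limits on $X$; (b) for every weak adequate domain of limits $(L', \preceq', \gamma')$ on $X$, every ideal of $X$ belongs to $\gamma'(L' \cup X)$. In this sense $\mathrm{Idl}(X)$, which coincides with the set $\mathcal{S}(X_a)$ of irreducible closed subsets of $X$ under the Alexandroff topology, is the smallest weak adequate domain of limits on $X$.
   Context: For a poset $(X,\le)$, ${\downarrow} E = \{y \mid \exists x\in E,\ y \le x\}$ and ${\downarrow} x = {\downarrow}\{x\}$. An ideal of $X$ is a nonempty downward closed subset $I$ that is directed: any two elements of $I$ have an upper bound in $I$. $\mathrm{Idl}(X)$ is the set of ideals, ordered by inclusion. $X_a$ is $X$ with the Alexandroff topology, whose opens are the upward closed sets; its closed sets are the downward closed sets. A closed set $F$ is irreducible if $F\ne\emptyset$ and $F \subseteq F_1 \cup F_2$ with $F_1,F_2$ closed implies $F\subseteq F_1$ or $F \subseteq F_2$. A well quasi-ordering is a well-founded quasi-ordering with no infinite antichain. A weak adequate domain of limits (WADL) on $X$ is a triple $(L, \preceq, \gamma)$ satisfying the following. - $L$ is a set disjoint from $X$, $\preceq$ is a binary relation on $L\cup X$, and $\gamma: L \cup X \to \mathcal{P}(X)$. - $(\mathrm{L}_1)$: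 each $\gamma(z)$ is downward closed, and $\gamma(x) = {\downarrow} x$ for $x \in X$. - $(\mathrm{L}_3)$: $z \preceq z'$ iff $\gamma(z)\subseteq\gamma(z')$. - $(\mathrm{L}_4)$: every downward closed $D\subseteq X$ equals $\bigcup_{z\in E}\gamma(z)$ for some finite $E \subseteq L\cup X$. Elements of $L$ are assumed distinct from elements of $X$, e.g. by tagging. *)

(* Defs.v *)
From HB Require Import structures.
From mathcomp Require Import all_boot all_order.
From mathcomp Require Import boolp classical_sets functions cardinality.
From mathcomp Require Import topology.

Set Implicit Arguments.
Unset Strict Implicit.
Unset Printing Implicit Defensive.

Import Order.Theory.
Local Open Scope classical_set_scope.
Local Open Scope order_scope.

(* On a [preorderType], [x < y] is the strict part of the quasi-ordering:
   [x <= y] and not [y <= x]. *)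
Definition antichain d (X : preorderType d) (A : set X) : Prop :=
  forall x y, A x -> A y -> x <> y -> x >< y.

Definition well_quasi_ordered d (X : preorderType d) : Prop :=
  well_founded (fun x y : X => x < y) /\
  forall A : set X, antichain A -> finite_set A.

Definition downward_closed d (X : porderType d) (D : set X) : Prop :=
  forall x y, y <= x -> D x -> D y.

Definition upward_closed d (X : porderType d) (U : set X) : Prop :=
  forall x y, x <= y -> U x -> U y.

Definition directed d (X : porderType d) (I : set X) : Prop :=
  forall x y, I x -> I y -> exists z, [/\ I z, x <= z & y <= z].

Definition Idl d (X : porderType d) : set (set X) :=
  [set J | [/\ J !=set0, downward_closed J & directed J]].
Arguments Idl {d} X.

(* Alias of a poset carrying its Alexandroff topology. *)
Definition alexandroff d (X : porderType d) : Type := X.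

Section AlexandroffTopology.
Context d (X : porderType d).

HB.instance Definition _ := Choice.on (alexandroff X).

Lemma upward_closedT : upward_closed [set: X].
Proof. by []. Qed.

Lemma upward_closedI (U V : set X) :
  upward_closed U -> upward_closed V -> upward_closed (U `&` V).
Proof. by move=> uU uV x y xy [Ux Vx]; split; [exact: uU Ux|exact: uV Vx]. Qed.

Lemma upward_closed_bigcup (J : Type) (f : J -> set X) :
  (forall j, upward_closed (f j)) -> upward_closed (\bigcup_j f j).
Proof. by move=> uf x y xy [j _ fjx]; exists j => //; exact: uf fjx. Qed.

HB.instance Definition _ := isOpenTopological.Build (alexandroff X)
  upward_closedT upward_closedI upward_closed_bigcup.

Lemma open_alexandroffE (U : set (alexandroff X)) :
  open U <-> @upward_closed d X U.
Proof. by []. Qed.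

Lemma closed_alexandroffE (F : set (alexandroff X)) :
  closed F <-> @downward_closed d X F.
Proof.
rewrite -openC open_alexandroffE; split=> uF x y.
- by move=> yx Fx; apply: contrapT => Fy; exact: (uF y x yx Fy).
- by move=> xy Fx Fy; exact: Fx (uF y x xy Fy).
Qed.

End AlexandroffTopology.

Definition irreducible_closed (T : topologicalType) : set (set T) :=
  [set F | [/\ closed F, F !=set0 &
    forall F1 F2 : set T, closed F1 -> closed F2 ->
      F `<=` F1 `|` F2 -> F `<=` F1 \/ F `<=` F2]].
Arguments irreducible_closed T : clear implicits.

(* The union of [X] with a set [L] disjoint from it is the tagged sum [L + X];
   [down] is the downward closure from [classical_sets]. *)
Record is_wadl d (X : porderType d) (L : Type)
    (prec : L + X -> L + X -> Prop) (gamma : L + X -> set X) : Prop := IsWadl {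
  wadl_downward_closed : forall z, downward_closed (gamma z);
  wadl_principal : forall x, gamma (inr x) = down [set x];
  wadl_precE : forall z z', prec z z' <-> gamma z `<=` gamma z';
  wadl_finite_union : forall D : set X, downward_closed D ->
    exists E : set (L + X), finite_set E /\ D = \bigcup_(z in E) gamma z
}.

Definition nonprincipal_Idl d (X : porderType d) : set (set X) :=
  Idl X `\` range (fun x : X => down [set x]).
Arguments nonprincipal_Idl {d} X.

Definition gamma_Idl d (X : porderType d) (z : nonprincipal_Idl X + X) :
    set X :=
  match z with
  | inl J => set_val J
  | inr x => down [set x]
  end.

Definition prec_Idl d (X : porderType d) (z z' : nonprincipal_Idl X + X) :
    Prop :=
  gamma_Idl z `<=` gamma_Idl z'.

(* Main.v *)
Require Import Defs.
From HB Require Import structures.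
From mathcomp Require Import all_boot all_order.
From mathcomp Require Import boolp classical_sets functions cardinality.
From mathcomp Require Import topology.

(** In a well-quasi-ordered poset every set has a finite basis of minimal
    elements, so strict inclusion of downward closed sets is well-founded.
    A minimal downward closed set that is not a finite union of ideals would be
    nonempty and not directed; if [x] and [y] have no upper bound in it, then it
    is the union of its two proper subsets obtained by removing the elements
    above [x], respectively above [y], a contradiction.  Minimality of [Idl X]
    holds because a directed set contained in a finite union of downward closed
    sets is contained in one of them. *)

Set Implicit Arguments.
Unset Strict Implicit.
Unset Printing Implicit Defensive.

Import Order.Theory.
Local Open Scope order_scope.
Local Open Scope classical_set_scope.

(** Induction on an enumeration of [E], directing the witness found so far with the one for the new
    index. The relation is abstract because it is used both for [<=] on [X] and for inclusion in a
    chain of sets. *)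
Lemma finite_directed_common (T U : Type) (le : U -> U -> Prop) (D : set U)
    (F : T -> set U) (E : set T) :
    finite_set E -> D !=set0 ->
    (forall u v, D u -> D v -> exists w, [/\ D w, le u w & le v w]) ->
    (forall t u v, le u v -> F t u -> F t v) ->
    (forall t, E t -> exists2 u, D u & F t u) ->
  exists2 u, D u & forall t, E t -> F t u.
Proof.
move=> /(@finite_seqP {classic T})[s ->] D0 Ddir Fup.
elim: s => [|t s IHs] DF; first by case: D0 => u Du; exists u.
have [t' st'|u Du Fu] := IHs; first by apply: DF; rewrite /= inE st' orbT.
have [|v Dv Fv] := DF t; first by rewrite /= inE eqxx.
have [w [Dw uw vw]] := Ddir u v Du Dv.
exists w => // t'; rewrite /= inE => /orP[/eqP ->|st'].
- exact: Fup vw Fv.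
- exact: Fup uw (Fu t' st').
Qed.

Section Ideals.
Context d (X : porderType d).
Implicit Types (x y : X) (D : set X).

Lemma downE x : down [set x] = [set y | y <= x].
Proof.
by apply/seteqP; split=> y /= => [[_ [->]]|yx] //; exists x.
Qed.

Lemma down_inj : injective (fun x => down [set x]).
Proof.
move=> x y; rewrite !downE => /seteqP[xy yx].
by apply/le_anti/andP; split; [exact: xy x (lexx x)|exact: yx y (lexx y)].
Qed.

Lemma Idl_down x : Idl X (down [set x]).
Proof.
rewrite downE; split=> [|y z zy yx|y z yx zx]; first by exists x => /=.
- exact: le_trans zy yx.
- by exists x; split => //=.
Qed.

Lemma downward_closed_remove D x :
  downward_closed D -> downward_closed (D `\` [set z | x <= z]).
Proof.
move=> dD y z zy [Dy xy]; split; first exact: dD Dy.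
by move=> /= xz; apply: xy; exact: le_trans zy.
Qed.

Lemma remove_cover D x y :
    ~ (exists z, [/\ D z, x <= z & y <= z]) ->
  D `<=` (D `\` [set z | x <= z]) `|` (D `\` [set z | y <= z]).
Proof.
move=> noub z Dz; have [xz|xz] := pselect (x <= z); last by left.
by right; split=> //= yz; apply: noub; exists z.
Qed.

(** If [D] left every [G t], then, complements being upward closed, directedness would give one
    point of [D] outside all of them. *)
Lemma directed_finite_cover (T : Type) (G : T -> set X) (E : set T) D :
    finite_set E -> (forall t, downward_closed (G t)) ->
    D !=set0 -> directed D -> D `<=` \bigcup_(t in E) G t ->
  exists2 t, E t & D `<=` G t.
Proof.
move=> finE dG D0 dirD DG; apply: contrapT => /forall2NP nDG.
have [|t x y xy|t Et|x Dx nGx] := @finite_directed_common T X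
  (fun x y => x <= y) D (fun t => ~` G t) E finE D0.
- exact: dirD.
- by apply: contra_not; exact: dG.
- have [//|/existsNP[x /not_implyP[Dx nGx]]] := nDG t.
  by exists x.
- by have [t Et Gx] := DG x Dx; exact: nGx Gx.
Qed.

Lemma Idl_irreducible : Idl X = irreducible_closed (alexandroff X).
Proof.
apply/seteqP; split=> [I [I0 dI dirI]|F [/closed_alexandroffE dF F0 irrF]].
- split=> //; first exact/closed_alexandroffE.
  move=> F1 F2 /closed_alexandroffE dF1 /closed_alexandroffE dF2 IF.
  (* Irreducibility is the case of a cover by two sets, indexed by [bool]. *)
  have [|||[] _ IFb] := @directed_finite_cover bool
    (fun b => if b then F1 else F2) setT I _ _ I0 dirI; [exact: finite_finset|by case| |by left|by right].
  by move=> x /IF[?|?]; [exists true|exists false].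
- split=> // x y Fx Fy; apply: contrapT => noub.
  (* Each of these two closed sets misses one of [x], [y], yet they cover [F]. *)
  have [|||FF|FF] := irrF (F `\` [set z : X | x <= z])
    (F `\` [set z : X | y <= z]).
  + exact/closed_alexandroffE/downward_closed_remove.
  + exact/closed_alexandroffE/downward_closed_remove.
  + exact: remove_cover.
  + by have [_ /(_ (lexx x))] := FF x Fx.
  + by have [_ /(_ (lexx y))] := FF y Fy.
Qed.

Definition finite_union_Idl D : Prop :=
  exists2 C : set (set X), finite_set C &
    C `<=` Idl X /\ D = \bigcup_(J in C) J.

Lemma finite_union_IdlU D1 D2 :
  finite_union_Idl D1 -> finite_union_Idl D2 -> finite_union_Idl (D1 `|` D2).
Proof.
move=> [C1 fC1 [IC1 ->]] [C2 fC2 [IC2 ->]]; exists (C1 `|` C2).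
- by rewrite finite_setU.
- by split; [move=> J [/IC1|/IC2]|rewrite bigcup_setU].
Qed.

Hypothesis wqoX : well_quasi_ordered X.

(** The minimal elements of [U] form an antichain, and well-foundedness puts one below each element
    of [U]. *)
Lemma wqo_finite_basis (U : set X) :
  exists2 M : set X, finite_set M &
    M `<=` U /\ forall x, U x -> exists2 m, M m & m <= x.
Proof.
have [wfX fin_anti] := wqoX.
exists [set m | U m /\ forall y, U y -> ~ y < m].
- apply: fin_anti => x y [Ux minx] [Uy miny] /eqP xy.
  apply/negP => /orP[] le_xy.
  + by apply: (miny x Ux); rewrite lt_neqAle xy.
  + by apply: (minx y Uy); rewrite lt_neqAle eq_sym xy.
- split=> [m []//|]; elim/(well_founded_ind wfX) => x IHx Ux.
  have [minx|] := pselect (forall y, U y -> ~ y < x).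
    by exists x.
  move=> /existsNP[y /not_implyP[Uy /contrapT yx]].
  have [m mM my] := IHx y yx Uy.
  by exists m => //; exact: le_trans (ltW yx).
Qed.

Lemma downward_closed_ind (Q : set X -> Prop) :
    (forall D, downward_closed D ->
      (forall D', downward_closed D' -> D' `<` D -> Q D') -> Q D) ->
  forall D, downward_closed D -> Q D.
Proof.
move=> IH D0 dD0; apply: contrapT => nQ0.
(* Zorn's lemma applies to the set [V] removed from [D0]. *)
have [F FP Ftot|V [[dV nQV] maxV]] := @Zorn_bigcup X
  (fun V => downward_closed (D0 `\` V) /\ ~ Q (D0 `\` V)).
- have [F0|] := pselect (F !=set0); last first.
    by move=> /nonemptyPn ->; rewrite bigcup_set0 setD0.
  (* Being finite, the basis [M] lies in a single member [A] of the chain. As [D0] minus [A] is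
     downward closed, all of [D0] above [M] is then in [A], so the union removes no more of [D0]
     than [A] does. *)
  have [M finM [MU basisM]] := wqo_finite_basis (D0 `&` \bigcup_(V in F) V).
  have [A B FA FB|x A B AB /AB//|x /MU[_ [A FA Ax]]|A FA MA] :=
    @finite_directed_common X (set X) subset F (fun x A => A x) M finM F0.
  + by have [AB|BA] := Ftot A B FA FB; [exists B|exists A]; split.
  + by exists A.
  + suff -> : D0 `\` \bigcup_(V in F) V = D0 `\` A by exact: FP.
    apply/seteqP; split=> x [D0x nx]; split=> //.
      by move=> Ax; apply: nx; exists A.
    move=> Fx; have [m Mm mx] := basisM x (conj D0x Fx).
    have [dA _] := FP A FA; have [_] := dA x m mx (conj D0x nx).
    by apply; exact: MA.
- apply/nQV/IH => // D' dD' [D'D DD']; apply: contrapT => nQD'.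
  (* A smaller counterexample [D'] would enlarge the removed set, against the maximality of [V]. *)
  have DE : D0 `\` (V `|` ~` D') = D'.
    apply/seteqP; split=> x; first by move=> [_ /not_orP[_ /contrapT]].
    by move=> D'x; have [D0x Vx] := D'D x D'x; split=> // -[].
  apply: (maxV (V `|` ~` D')); last by rewrite DE.
  split=> [x|VD']; first by left.
  apply: DD' => x [D0x Vx]; apply: contrapT => D'x.
  by apply/Vx/VD'; right.
Qed.

Lemma downward_closed_finite_union_Idl D :
  downward_closed D -> finite_union_Idl D.
Proof.
elim/downward_closed_ind => {}D dD IH.
have [D0|/nonemptyPn ->] := pselect (D !=set0); last first.
  by exists set0 => //; split; [exact: sub0set|rewrite bigcup_set0].
have [dirD|] := pselect (directed D).
  by exists [set D] => //; split; [move=> _ ->|rewrite bigcup_set1].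
move=> /existsNP[x /existsNP[y /not_implyP[Dx /not_implyP[Dy noub]]]].
have fin_remove z : D z -> finite_union_Idl (D `\` [set t | z <= t]).
  move=> Dz; apply: IH; first exact: downward_closed_remove.
  by split=> [t []//|/(_ z Dz)[_ /(_ (lexx z))]].
suff -> : D = (D `\` [set z | x <= z]) `|` (D `\` [set z | y <= z]).
  exact: finite_union_IdlU (fin_remove x Dx) (fin_remove y Dy).
by apply/seteqP; split=> [|z [[]|[]]//]; exact: remove_cover.
Qed.

End Ideals.

(** The two tags never collide since [L] excludes the principal ideals. *)
Lemma gamma_Idl_inj d (X : porderType d) : injective (@gamma_Idl d X).
Proof.
move=> [J|x] [K|y] /= => [/val_inj ->//|JE|KE|/down_inj ->//].
- by have /set_mem[_ []] := valP J; exists y.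
- by have /set_mem[_ []] := valP K; exists x.
Qed.

Lemma gamma_Idl_Idl d (X : porderType d) (z : nonprincipal_Idl X + X) :
  Idl X (gamma_Idl z).
Proof.
case: z => [J|x]; last exact: Idl_down.
by have /set_mem[] := valP J.
Qed.

Lemma gamma_Idl_surj d (X : porderType d) (I : set X) :
  Idl X I -> exists z, gamma_Idl z = I.
Proof.
move=> idlI; have [[x _ <-]|npI] := pselect (range (fun x => down [set x]) I).
- by exists (inr x).
- have npJ : I \in nonprincipal_Idl X by apply/mem_set; split.
  by exists (inl (SigSub npJ)).
Qed.

Local Close Scope order_scope.

Theorem theorem3p4 (d : Order.disp_t) (X : porderType d)
    (wqoX : well_quasi_ordered X) :
  [/\ is_wadl (@prec_Idl d X) (@gamma_Idl d X),
      forall (L' : Type) (prec' : L' + X -> L' + X -> Prop)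
          (gamma' : L' + X -> set X),
        is_wadl prec' gamma' -> Idl X `<=` range gamma',
      set_bij [set: nonprincipal_Idl X + X] (Idl X) (@gamma_Idl d X)
    & Idl X = irreducible_closed (alexandroff X)].
Proof.
split; last exact: Idl_irreducible.
- split=> // [z|D dD]; first by have [] := gamma_Idl_Idl z.
  have [C finC [CI ->]] := downward_closed_finite_union_Idl wqoX dD.
  (* Injectivity makes this preimage finite; surjectivity onto the ideals makes it reach all of
     [C]. *)
  exists (@gamma_Idl d X @^-1` C); split.
    by apply: finite_preimage => // z z' _ _; exact: gamma_Idl_inj.
  apply/seteqP; split=> x [].
  + move=> J CJ Jx; have [z zJ] := gamma_Idl_surj (CI J CJ).
    by exists z; rewrite /= zJ.
  + by move=> z Cz zx; exists (gamma_Idl z).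
- move=> L' prec' gamma' wadl I [I0 dI dirI].
  (* The ideal lies inside one of the finitely many pieces whose union it is, hence equals that
     piece. *)
  have [E [finE IE]] := wadl_finite_union wadl dI.
  have [|z Ez Iz] := directed_finite_cover finE
    (wadl_downward_closed wadl) I0 dirI.
    by rewrite -IE.
  exists z => //; apply/seteqP; split=> //.
  by rewrite [X in _ `<=` X]IE; exact: bigcup_sup.
- split=> [z _|z z' _ _|I /gamma_Idl_surj[z <-]]; first exact: gamma_Idl_Idl.
    exact: gamma_Idl_inj.
  by exists z.
Qed.
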